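(* Let $\mathcal{H}$ and $\mathcal{G}$ be real Hilbert spaces, let $A:\mathcal{H}\to 2^{\mathcal{H}}$ be maximally $\rho$-monotone for some $\rho\in\mathbb{R}$, let $B:\mathcal{G}\to 2^{\mathcal{G}}$ be maximally monotone, let $L:\mathcal{H}\to\mathcal{G}$ be a bounded linear operator with adjoint $L^*$, let $C:\mathcal{H}\to\mathcal{H}$ be $\zeta$-Lipschitz for some $\zeta\in\,]0,+\infty[$, and let $D:\mathcal{H}\to\mathcal{H}$ be $\beta$-cocoercive for some $\beta\in\,]0,+\infty[$. Suppose that $A+C$ is maximally monotone and that the set $$\boldsymbol{Z}=\{(x,u)\in\mathcal{H}\times\mathcal{G}\;:\;0\in Ax+Cx+Dx+L^*u\ \text{ and }\ 0\in B^{-1}u-Lx\}$$ is nonempty. Let $(\sigma,\tau)\in\,]0,+\infty[^2$ with $\tau\rho>-1$, let $\varepsilon\in\,]0,1[$, let $(x_0,u_0)\in\mathcal{H}\times\mathcal{G}$, and let the sequences $(z_{n+1})_{n\in\mathbb{N}}$, $(x_n)_{n\in\mathbb{N}}$, $(u_n)_{n\in\mathbb{N}}$ be generated by, for every $n\in\mathbb{N}$, $$\begin{aligned} p_{n+1}&=Cx_n,\\ z_{n+1}&=J_{\tau A}\big(x_n-\tau(L^*u_n+p_{n+1}+Dx_n)\big),\\ q_{n+1}&=\tau(Cz_{n+1}-p_{n+1}),\\ u_{n+1}&=J_{\sigma B^{-1}}\big(u_n+\sigma L(2z_{n+1}-x_n-q_{n+1})\big),\\ x_{n+1}&=z_{n+1}-q_{n+1}.\end{aligned}$$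 Suppose that $$\tau\le 2\beta\varepsilon\qquad\text{and}\qquad \tau\sigma\|L\|^2+\tau^2\zeta^2<1-\varepsilon.$$ Then the following statements hold: 1. $\sum_{k=0}^{\infty}\|z_{k+1}-x_k\|^2<+\infty$, $\sum_{k=0}^{\infty}\|x_{k+1}-x_k\|^2<+\infty$, and $\sum_{k=0}^{\infty}\|u_{k+1}-u_k\|^2<+\infty$. 2. There exists $(x,u)\in\boldsymbol{Z}$ such that $(x_n,u_n)\rightharpoonup(x,u)$ weakly in $\mathcal{H}\times\mathcal{G}$.
   Context: For a set-valued operator $A:\mathcal{H}\to 2^{\mathcal{H}}$, its graph is $\{(x,u): u\in Ax\}$ and its inverse is $A^{-1}u=\{x: u\in Ax\}$. For $\rho\in\mathbb{R}$, $A$ is $\rho$-monotone if $\langle x-y\mid u-v\rangle\ge\rho\|x-y\|^2$ for all $(x,u),(y,v)$ in its graph; it is maximally $\rho$-monotone if it is $\rho$-monotone and its graph is maximal for inclusion among graphs of $\rho$-monotone operators. (Maximally) monotone means (maximally) $0$-monotone. The resolvent is $J_A=(\mathrm{Id}+A)^{-1}$; it is single valued (and everywhere defined) when $A$ is maximally $\rho$-monotone with $\rho>-1$. An operator $T:\mathcal{H}\to\mathcal{H}$ is $\beta$-cocoercive if $\langle x-y\mid Tx-Ty\rangle\ge\beta\|Tx-Ty\|^2$ for all $x,y\in\mathcal{H}$, and $\zeta$-Lipschitz if $\|Tx-Ty\|\le\zeta\|x-y\|$ for all $x,y\in\mathcal{H}$. *)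

(* Defs.v *)
From HB Require Import structures.
From mathcomp Require Export all_boot all_order all_algebra.
From mathcomp Require Export all_classical all_reals all_analysis.
Export Order.TTheory GRing.Theory Num.Theory.
Export numFieldNormedType.Exports.

Set Implicit Arguments.
Unset Strict Implicit.
Unset Printing Implicit Defensive.

Local Open Scope classical_set_scope.
Local Open Scope ring_scope.

(* MathComp-Analysis has no Hilbert spaces: a real Hilbert space is a complete
   normed module whose norm is induced by a symmetric positive definite
   bilinear form ({dot V for idfun}, from sesquilinear.v). *)
HB.mixin Record CompleteNormedModule_isHilbert (R : realType) V
    of CompleteNormedModule R V := {
  inner : {dot V for (@idfun R)} ;
  innerxx : forall x : V, inner x x = `|x| ^+ 2
}.

#[short(type="hilbertType")]
HB.structure Definition Hilbert (R : realType) :=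
  {V of CompleteNormedModule_isHilbert R V & CompleteNormedModule R V}.

Notation "''[' x , y ]" := (inner x%R y%R) : ring_scope.

(* Set-valued operators U -> 2^V are functions U -> set V *)

Definition op_graph (U V : Type) (A : U -> set V) : set (U * V) :=
  [set xu | A xu.1 xu.2].

Definition op_inv (U V : Type) (A : U -> set V) : V -> set U :=
  fun u => [set x | A x u].

Definition op_of_fun (U V : Type) (f : U -> V) : U -> set V :=
  fun x => [set f x].

Definition op_add (U : Type) (V : zmodType) (A B : U -> set V) : U -> set V :=
  fun x => [set w | exists u v, [/\ A x u, B x v & w = u + v]].

Definition op_scale (R : realType) (U : Type) (V : lmodType R) (a : R)
  (A : U -> set V) : U -> set V := fun x => [set a *: u | u in A x].

Definition rho_monotone (R : realType) (V : hilbertType R) (rho : R)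
    (A : V -> set V) :=
  forall x u y v : V, op_graph A (x, u) -> op_graph A (y, v) ->
    '[x - y, u - v] >= rho * `|x - y| ^+ 2.

Definition maximally_rho_monotone (R : realType) (V : hilbertType R) (rho : R)
    (A : V -> set V) :=
  rho_monotone rho A /\
  forall B : V -> set V, rho_monotone rho B ->
    op_graph A `<=` op_graph B -> op_graph B = op_graph A.

Definition maximally_monotone (R : realType) (V : hilbertType R)
  (A : V -> set V) := maximally_rho_monotone 0 A.

(* Set-valued: z = J_A y is written resolvent A y z *)
Definition resolvent (V : zmodType) (A : V -> set V) : V -> set V :=
  op_inv (op_add (op_of_fun id) A).

Definition cocoercive (R : realType) (V : hilbertType R) (beta : R)
    (T : V -> V) :=
  forall x y : V, '[x - y, T x - T y] >= beta * `|T x - T y| ^+ 2.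

Definition bounded_operator (R : realType) (V W : normedModType R)
    (L : V -> W) :=
  exists M : R, forall x : V, `|L x| <= M * `|x|.

Definition op_norm (R : realType) (V W : normedModType R) (L : V -> W) : R :=
  sup [set `|L x| | x in [set x : V | `|x| <= 1]].

Definition is_adjoint (R : realType) (V W : hilbertType R) (L : V -> W)
    (Ls : W -> V) :=
  forall (x : V) (u : W), '[L x, u] = '[x, Ls u].

(* On a product this uses the library's maximum norm, which is equivalent to
   the Hilbert norm of the direct sum and so has the same dual and the same
   weak convergence. *)
Definition weakly_cvg (R : realType) (V : normedModType R) (x : nat -> V)
    (l : V) :=
  forall f : {linear V -> R^o}, continuous f ->
    f (x n) @[n --> \oo] --> f l.

Definition pd_solutions (R : realType) (H G : hilbertType R) (A : H -> set H)
    (B : G -> set G) (C D : H -> H) (L : H -> G) (Ls : G -> H) :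
    set (H * G) :=
  [set xu | [set a + C xu.1 + D xu.1 + Ls xu.2 | a in A xu.1] 0 /\
            [set y - L xu.1 | y in op_inv B xu.2] 0].

(* Main.v *)
Require Import Defs.
From mathcomp Require Import ring lra.

(* Adding C z_{n+1} on both sides of the first resolvent inclusion gives
     (x_n - x_{n+1}) / tau - L^* u_n - D x_n \in (A + C) z_{n+1},
   so that A enters only through the maximally monotone operator A + C.
   Monotonicity of A + C and B against a point (x, u) of Z shows that
     |x_n - x|^2 / tau - 2 <L (x_n - x), u_n - u> + |u_n - u|^2 / sigma
   decreases at each step by at least a multiple of
     |z_{n+1} - x_n|^2 + |u_{n+1} - u_n|^2 + |D x_n - D x|^2;
   the strictness of the step size condition is what leaves room for the last
   term. Hence D x_n converges strongly to D x, and a weak limit of (x_n, u_n)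
   along an ultrafilter lies in Z by maximality of A + C and of B separately,
   the skew part (L^* u, - L x) being cancelled by hand. Opial's argument makes
   all these weak limits equal. Weak compactness of bounded sequences along
   ultrafilters follows from the Riesz representation theorem. *)

Set Implicit Arguments.
Unset Strict Implicit.
Unset Printing Implicit Defensive.

Local Open Scope classical_set_scope.
Local Open Scope ring_scope.

(** * Inner products and the Riesz representation theorem *)

Lemma cvg_dist0P (R : realType) (V : normedModType R) (T : Type)
    (F : set_system T) {FF : Filter F} (f : T -> V) (a : V) :
  `|f n - a| @[n --> F] --> (0 : R) <-> f n @[n --> F] --> a.
Proof.
by split=> [/norm_cvg0P/subr_cvg0|?]; [|apply/norm_cvg0P/subr_cvg0].
Qed.

Lemma cvg_dist_le (R : realType) (V : normedModType R) (T : Type)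
    (F : set_system T) {FF : Filter F} (f : T -> V) (a : V) (g : T -> R) :
  (forall n, `|f n - a| <= g n) -> g n @[n --> F] --> 0 ->
  f n @[n --> F] --> a.
Proof.
move=> fg g0; apply/cvg_dist0P.
apply: (@squeeze_cvgr _ _ _ _ (fun=> 0) g) => //; last exact: cvg_cst.
by near=> n; rewrite normr_ge0 fg.
Unshelve. all: by end_near. Qed.

Section InnerProduct.
Context {R : realType} {V : hilbertType R}.
Implicit Types x y z : V.

Lemma innerC x y : '[x, y] = '[y, x].
Proof. by rewrite (hermC inner x y) expr0 mul1r. Qed.

Lemma innerDl x y z : '[x + y, z] = '[x, z] + '[y, z].
Proof. exact: linearDl. Qed.

Lemma innerNl x y : '[- x, y] = - '[x, y].
Proof. exact: linearNl. Qed.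

Lemma innerZl a x y : '[a *: x, y] = a * '[x, y].
Proof. exact: linearZl_LR. Qed.

Lemma innerDr x y z : '[x, y + z] = '[x, y] + '[x, z].
Proof. by rewrite !(innerC x) innerDl. Qed.

Lemma innerNr x y : '[x, - y] = - '[x, y].
Proof. by rewrite !(innerC x) innerNl. Qed.

Lemma innerZr a x y : '[x, a *: y] = a * '[x, y].
Proof. by rewrite !(innerC x) innerZl. Qed.

Lemma inner0l x : '[0, x] = 0.
Proof. by rewrite -(scale0r x) innerZl mul0r. Qed.

Lemma inner0r x : '[x, 0] = 0.
Proof. by rewrite innerC inner0l. Qed.

Definition innerE :=
  (innerDl, innerDr, innerNl, innerNr, innerZl, innerZr, inner0l, inner0r).

Lemma normD_sq x y : `|x + y| ^+ 2 = `|x| ^+ 2 + 2 * '[x, y] + `|y| ^+ 2.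
Proof. by rewrite -!innerxx !innerE (innerC y x); ring. Qed.

Lemma normB_sq x y : `|x - y| ^+ 2 = `|x| ^+ 2 - 2 * '[x, y] + `|y| ^+ 2.
Proof. by rewrite -!innerxx !innerE (innerC y x); ring. Qed.

Lemma inner_le_norm x y : '[x, y] <= `|x| * `|y|.
Proof.
have [->|x0] := eqVneq x 0; first by rewrite inner0l normr0 mul0r.
have [->|y0] := eqVneq y 0; first by rewrite inner0r normr0 mulr0.
have xy0 : 0 < `|x| * `|y| by rewrite mulr_gt0 ?normr_gt0.
have := sqr_ge0 `| `|y| *: x - `|x| *: y |.
rewrite normB_sq !normrZ !normr_id !innerE => h.
rewrite -(ler_pM2l xy0); nra.
Qed.

Lemma norm_inner_le x y : `|'[x, y]| <= `|x| * `|y|.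
Proof.
rewrite ler_norml inner_le_norm andbT lerNl -innerNl.
by rewrite (le_trans (inner_le_norm _ _))// normrN.
Qed.

(* The functional [y |-> |y|^2 - 2 f y] is minimal exactly at the
   representative of [f]; minimizing sequences are Cauchy by the parallelogram
   identity. *)
Theorem riesz_representation (f : V -> R) (M : R) : scalar f ->
  (forall x, `|f x| <= M * `|x|) -> exists a, forall x, f x = '[a, x].
Proof.
move=> flin fM.
have fD x y : f (x + y) = f x + f y.
  by rewrite -[x]scale1r flin mul1r scale1r.
have f0 : f 0 = 0 by apply: (addIr (f 0)); rewrite -fD !add0r.
have fZ k x : f (k *: x) = k * f x by rewrite -[k *: x]addr0 flin f0 addr0.
have fN x : f (- x) = - f x by rewrite -scaleN1r fZ mulN1r.
pose J y := `|y| ^+ 2 - 2 * f y.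
have JM y : - M ^+ 2 <= J y.
  have := fM y; rewrite ler_norml => /andP[_ h].
  by have := sqr_ge0 (`|y| - M); rewrite /J; nra.
have Jinf : has_inf (range J).
  by split; [exists (J 0), 0 | exists (- M ^+ 2) => _ [y _ <-]; exact: JM].
pose m := inf (range J).
have mJ y : m <= J y by apply: ge_inf; [exact: Jinf.2 | exists y].
have Jmid y y' : `|y - y'| ^+ 2 <= 2 * (J y - m) + 2 * (J y' - m).
  have := mJ ((2^-1) *: (y + y')).
  rewrite /J normB_sq normrZ fZ fD exprMn normD_sq ger0_norm ?invr_ge0//.
  by rewrite exprVn; lra.
have ymin (k : nat) : exists y, J y - m < k.+1%:R^-1.
  have k0 : 0 < k.+1%:R^-1 :> R by rewrite invr_gt0.
  have [_ [y _ <-] h] := inf_adherent k0 Jinf.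
  by exists y; rewrite ltrBlDl.
have [y yJ] := choice ymin.
have ycvg : cvgn y.
  apply/cauchy_cvgP/cauchy_exP => e e0.
  have e2 : 0 < e ^+ 2 / 4 by rewrite divr_gt0 ?exprn_gt0.
  have [N _ hN] : \forall n \near \oo, n.+1%:R^-1 < e ^+ 2 / 4 :> R.
    exact: near_infty_natSinv_lt (PosNum e2).
  exists (y N); exists N => //= n Nn.
  rewrite -ball_normE /= -(@ltr_pXn2r _ 2) ?nnegrE ?normr_ge0 ?(ltW e0)//.
  apply: le_lt_trans (Jmid _ _) _.
  have yJe k : (N <= k)%N -> J (y k) - m < e ^+ 2 / 4.
    by move=> Nk; exact: lt_trans (yJ k) (hN _ Nk).
  by have := yJe N (leqnn N); have := yJe n Nn; lra.
pose a := limn y.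
have fy : f (y n) @[n --> \oo] --> f a.
  apply: (@cvg_dist_le _ _ _ _ _ _ _ (fun n => M * `|y n - a|)).
    by move=> n; rewrite -fN -fD fM.
  by rewrite -(mulr0 M); apply: cvgM; [exact: cvg_cst | apply/cvg_dist0P].
have Jy : J (y n) @[n --> \oo] --> J a.
  apply: cvgB; last by apply: cvgM => //; exact: cvg_cst.
  by rewrite expr2; apply: cvgM; apply: cvg_norm.
have Jam : J a <= m.
  have h : m + n.+1%:R^-1 @[n --> \oo] --> m + 0.
    by apply: cvgD; [exact: cvg_cst | exact: cvg_harmonic].
  rewrite -(addr0 m) -(cvg_lim _ Jy)// -(cvg_lim _ h)//.
  apply: ler_lim; [exact: cvgP Jy | exact: cvgP h | near=> k].
  by rewrite -lerBlDl ltW.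
exists a => x.
set g := '[a, x] - f x.
have s0 : `|x| ^+ 2 + 1 != 0 by rewrite gt_eqF// ltr_wpDl.
(* Perturbing the minimizer along [x] changes [J] by [2 t g + t^2 |x|^2], which for this [t] is
   [- t^2 (|x|^2 + 2)], hence [t = 0]. The summand 1 avoids a separate case [x = 0]. *)
pose t := - g / (`|x| ^+ 2 + 1).
have tg : g = - (t * (`|x| ^+ 2 + 1)) by rewrite /t divfK// opprK.
have := le_trans Jam (mJ (a + t *: x)).
rewrite /J normD_sq fD fZ innerZr normrZ exprMn real_normK ?num_real// => h.
have t2 : t ^+ 2 <= 0.
  by have := sqr_ge0 (t * `|x|); rewrite /g in tg; nra.
have t0 : t = 0 by apply/eqP; rewrite -sqrf_eq0 eq_le t2 sqr_ge0.
by apply/eqP; rewrite eq_sym -subr_eq0 -/g tg t0 mul0r oppr0.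
Unshelve. all: by end_near. Qed.

Lemma cvg_inner (T : Type) (F : set_system T) {FF : Filter F} (s : T -> V)
    (a b : V) :
  s n @[n --> F] --> b -> '[a, s n] @[n --> F] --> '[a, b].
Proof.
move=> sb; apply: (@cvg_dist_le _ _ _ _ _ _ _ (fun n => `|a| * `|s n - b|)).
  by move=> n; rewrite -innerNr -innerDr norm_inner_le.
by rewrite -(mulr0 `|a|); apply: cvgM; [exact: cvg_cst | apply/cvg_dist0P].
Qed.

(** Tested against vectors rather than functionals, which is equivalent by Riesz, and along any
    filter, so that ultrafilters are covered. *)
Definition weak_cvg_to (T : Type) (F : set_system T) (x : T -> V) (a : V) :=
  forall y, '[x n, y] @[n --> F] --> '[a, y].

(** A weak limit may be paired with a strong one: after splitting [s n] as [b + (s n - b)], the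
    second part is at most [M |s n - b|]. The bound [M] is a hypothesis because convergence along a
    general filter does not imply boundedness. *)
Lemma cvg_inner_weak (T : Type) (F : set_system T) {FF : Filter F}
    (x s : T -> V) (a b : V) (M : R) : (forall n, `|x n| <= M) ->
  weak_cvg_to F x a -> s n @[n --> F] --> b ->
  '[x n, s n] @[n --> F] --> '[a, b].
Proof.
move=> xM xa sb.
rewrite -(addr0 '[a, b]).
have -> : (fun n => '[x n, s n]) = (fun n => '[x n, b] + '[x n, s n - b]).
  by apply/funext => n; rewrite !innerE; ring.
apply: cvgD; first exact: xa.
apply: (@cvg_dist_le _ _ _ _ _ _ _ (fun n => M * `|s n - b|)).
  move=> n; rewrite subr0 (le_trans (norm_inner_le _ _))//.
  by rewrite ler_wpM2r.
by rewrite -(mulr0 M); apply: cvgM; [exact: cvg_cst | apply/cvg_dist0P].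
Qed.

Lemma weak_cvgD (T : Type) (F : set_system T) {FF : Filter F}
    (x s : T -> V) (a b : V) :
  weak_cvg_to F x a -> s n @[n --> F] --> b ->
  weak_cvg_to F (fun n => x n + s n) (a + b).
Proof.
move=> xa sb y; rewrite innerDl.
under eq_fun do rewrite innerDl.
apply: cvgD; first exact: xa.
under eq_fun do rewrite innerC.
by rewrite innerC; exact: cvg_inner.
Qed.

End InnerProduct.

(** * Ultrafilter limits and weak compactness *)

(** The image ultrafilter lives on a compact segment, so it has a cluster point, and an ultrafilter
    converges to each of its cluster points. *)
Lemma ultra_bounded_cvg (R : realType) (T : Type) (U : set_system T)
    {UU : UltraFilter U} (f : T -> R) (M : R) :
  (forall n, `|f n| <= M) -> exists l : R, f n @[n --> U] --> l.
Proof.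
move=> fM.
have fU : (f @ U) `[- M, M]%classic.
  by apply: nearW => n; rewrite /= in_itv /= -ler_norml.
have [l [_ lU]] := segment_compact _ fU.
exists l => N Nl; have [//|UN] := in_ultra_setVsetC (f @^-1` N) UU.
by have [A []] := lU (~` N) N UN Nl.
Qed.

(** If a neighbourhood [N] were missed, [F] restricted to the complement of its preimage would be
    proper, and an ultrafilter refining it could not converge to [l]. *)
Lemma cvg_ultra (T : Type) (S : topologicalType) (F : set_system T)
    {FF : ProperFilter F} (f : T -> S) (l : S) :
  (forall U, UltraFilter U -> F `<=` U -> f n @[n --> U] --> l) ->
  f n @[n --> F] --> l.
Proof.
move=> fU N Nl; apply: contrapT => nFN.
pose G := within (~` (f @^-1` N)) F.
have GF : ProperFilter G.
  apply: Build_ProperFilter => h; apply: nFN; rewrite /G /within /= in h.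
  by apply: filterS h => n; apply: contrapT.
have [U [UU GU]] := ultraFilterLemma GF.
have FU : F `<=` U by move=> A FA; apply: GU; apply: filterS FA.
have UN : U (~` (f @^-1` N)) by apply: GU; apply: nearW.
have UfN : U (f @^-1` N) by exact: fU Nl.
apply: (@filter_not_empty _ U).
by rewrite -(setICl (f @^-1` N)); exact: filterI.
Qed.

(** The limits of ['[x n, y]] along [U] form a bounded linear functional of [y], which Riesz
    represents by the weak limit. *)
Lemma ultra_weak_compact (R : realType) (V : hilbertType R) (T : Type)
    (U : set_system T) {UU : UltraFilter U} (x : T -> V) (M : R) :
  (forall n, `|x n| <= M) -> exists a, weak_cvg_to U x a.
Proof.
move=> xM.
have xyM y n : `|'[x n, y]| <= M * `|y|.
  by rewrite (le_trans (norm_inner_le _ _))// ler_wpM2r.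
have [f xf] := choice (fun y => ultra_bounded_cvg (xyM y)).
have [a fa] : exists a, forall y, f y = '[a, y].
  apply: (@riesz_representation _ _ _ M) => [k y w|y].
    apply: (cvg_unique _ (xf (k *: y + w))) => //.
    have -> : (fun n => '[x n, k *: y + w]) =
        (fun n => k * '[x n, y] + '[x n, w]).
      by apply/funext => n; rewrite innerDr innerZr.
    by apply: cvgD => //; apply: cvgM => //; exact: cvg_cst.
  have xfy : `|'[x n, y]| @[n --> U] --> `|f y| by exact: cvg_norm.
  by apply: (cvgr_to_le xfy); near=> k; exact: xyM.
by exists a => y; rewrite -fa.
Unshelve. all: by end_near. Qed.

Lemma norm_sq_cvg0 (R : realType) (V : normedModType R) (T : Type)
    (F : set_system T) {FF : Filter F} (f : T -> V) :
  `|f n| ^+ 2 @[n --> F] --> (0 : R) -> f n @[n --> F] --> 0.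
Proof.
move=> f0; apply/cvgr0Pnorm_le => e e0.
have e20 : 0 < e ^+ 2 by rewrite exprn_gt0.
apply: filterS ((cvgr0Pnorm_le _).1 f0 _ e20) => n.
by rewrite normrX normr_id ler_pXn2r ?nnegrE ?normr_ge0 ?(ltW e0).
Qed.

Lemma op_norm_le (R : realType) (V W : normedModType R) (L : {linear V -> W}) :
  bounded_operator L -> forall x, `|L x| <= op_norm L * `|x|.
Proof.
move=> [M LM] x.
have [->|x0] := eqVneq x 0; first by rewrite linear0 !normr0 mulr0.
have x_gt0 : 0 < `|x| by rewrite normr_gt0.
rewrite -ler_pdivrMr//.
have -> : `|L x| / `|x| = `|L (`|x|^-1 *: x)|.
  by rewrite linearZ normrZ ger0_norm ?invr_ge0// mulrC.
apply: ub_le_sup; last first.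
  exists (`|x|^-1 *: x) => //=.
  by rewrite normrZ ger0_norm ?invr_ge0// mulVf ?gt_eqF.
exists `|M| => _ [y /= y1 <-].
rewrite (le_trans (LM y))// (le_trans (ler_norm _))// normrM normr_id.
by rewrite ler_piMr.
Qed.

(** * Maximally monotone operators *)

Section MaximalMonotone.
Context {R : realType}.

(** The hypothesis says that the graph stays monotone when [(x, u)] is added to it, so by maximality
    nothing was added. *)
Lemma maximally_monotone_mem (V : hilbertType R) (A : V -> set V) (x u : V) :
  maximally_monotone A ->
  (forall y v, A y v -> 0 <= '[x - y, u - v]) -> A x u.
Proof.
move=> [Amon Amax] h.
pose B : V -> set V := fun y => A y `|` [set v | y = x /\ v = u].
suff BA : op_graph B = op_graph A.
  suff : op_graph B (x, u) by rewrite BA.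
  by right.
apply: Amax => [y v w b|[y v] Ayv]; last by left.
rewrite mul0r => -[Ayv|/= [-> ->]] [Awb|/= [-> ->]].
- by have := Amon _ _ _ _ Ayv Awb; rewrite mul0r.
- by rewrite -[v - u]opprB -[y - x]opprB innerNl innerNr opprK h.
- exact: h.
- by rewrite subrr inner0l.
Qed.

(* If [u] were not in [A x], some [(y, v)] in the graph would make the first
   product negative, so every second product would be positive, putting
   [(p, r)] in the graph of [B]; taking [(w, b) = (p, r)] is then absurd. *)
Lemma maximally_monotone_mem_pair (V W : hilbertType R) (A : V -> set V)
    (B : W -> set W) (x u : V) (p r : W) :
  maximally_monotone A -> maximally_monotone B ->
  (forall y v w b, A y v -> B w b ->
    0 <= '[x - y, u - v] + '[p - w, r - b]) -> A x u /\ B p r.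
Proof.
move=> mA mB h.
have Axu : A x u.
  apply: (maximally_monotone_mem mA) => y v Ayv.
  rewrite leNgt; apply/negP => neg.
  have Bpr : B p r.
    apply: (maximally_monotone_mem mB) => w b Bwb.
    by have := h _ _ _ _ Ayv Bwb; lra.
  by have := h _ _ _ _ Ayv Bpr; rewrite !subrr inner0l; lra.
split=> //; apply: (maximally_monotone_mem mB) => w b Bwb.
by have := h _ _ _ _ Axu Bwb; rewrite !subrr inner0l add0r.
Qed.

End MaximalMonotone.

(** * Scalar inequalities and summability *)

Lemma binary_form_coercive (R : realType) (a b N : R) :
  0 < a -> 0 < b -> N ^+ 2 < a * b ->
  exists2 c, 0 < c &
    forall r t,
      c * (r ^+ 2 + t ^+ 2) <= a * r ^+ 2 - 2 * N * r * t + b * t ^+ 2.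
Proof.
move=> a0 b0 Nab.
have ab0 : 0 < a + b by rewrite addr_gt0.
(* Determinant over trace of the symmetric matrix with diagonal [a], [b] and off-diagonal entry
   [- N]: a positive lower bound of its smaller eigenvalue. *)
pose c := (a * b - N ^+ 2) / (a + b).
have c0 : 0 < c by rewrite divr_gt0 ?subr_gt0.
exists c => // r t.
have cE : c * (a + b) = a * b - N ^+ 2 by rewrite /c divfK ?gt_eqF.
have ac0 : 0 < a - c.
  rewrite -(pmulr_lgt0 _ ab0) mulrBl cE.
  by have := sqr_ge0 N; nra.
(* [(a - c) (b - c) = N^2 + c^2] *)
rewrite -subr_ge0 -(pmulr_rge0 _ ac0).
have -> : (a - c) * (a * r ^+ 2 - 2 * N * r * t + b * t ^+ 2
    - c * (r ^+ 2 + t ^+ 2)) =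
  ((a - c) * r - N * t) ^+ 2 + (a * b - c * (a + b) + c ^+ 2 - N ^+ 2) * t ^+ 2.
  by ring.
have := sqr_ge0 (c * t); have := sqr_ge0 ((a - c) * r - N * t).
by rewrite cE; nra.
Qed.

Lemma telescoping_summable (R : realType) (c : R) (V f : nat -> R) :
  0 < c -> (forall n, 0 <= V n) -> (forall n, 0 <= f n) ->
  (forall n, V n.+1 + c * f n <= V n) ->
  (\sum_(0 <= k <oo) (f k)%:E < +oo)%E /\ f n @[n --> \oo] --> 0.
Proof.
move=> c0 V0 f0 Vf.
have sumf n : \sum_(0 <= i < n) f i <= V 0 / c.
  rewrite ler_pdivlMr// mulrC.
  suff : V n + c * \sum_(0 <= i < n) f i <= V 0.
    by have := V0 n; lra.
  elim: n => [|n ih]; first by rewrite big_geq// mulr0 addr0.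
  by rewrite big_nat_recr//= mulrDr; have := Vf n; lra.
split.
  apply: (@le_lt_trans _ _ (V 0 / c)%:E); last exact: ltry.
  apply: lime_le; first by apply: is_cvg_nneseries => n _ _; rewrite lee_fin.
  by near=> n; rewrite sumEFin lee_fin.
apply: cvg_series_cvg_0; apply: nondecreasing_is_cvgn.
  by apply: nondecreasing_series => n _ _.
by exists (V 0 / c) => _ [n _ <-]; exact: sumf.
Unshelve. all: by end_near. Qed.

(** * The primal-dual quadratic form *)

Section PrimalDualForm.
Context {R : realType} {H G : hilbertType R} (L : {linear H -> G}) (t s : R).

(** The form of the block operator with diagonal [t Id], [s Id] and off-diagonal blocks given by
    [- L] and its adjoint; for [t = tau^-1] and [s = sigma^-1] this is the usual primal-dual
    metric. *)
Definition pd_form (x : H) (u : G) : R :=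
  t * `|x| ^+ 2 - 2 * '[L x, u] + s * `|u| ^+ 2.

(** The right side minus the left is exactly twice the sum of the two hypotheses, in which
    ['[L (X + q), U]] cancels. In the use, [X = x_{n+1} - x], [q = z_{n+1} - x_{n+1}],
    [U = u_{n+1} - u], [dx] and [du] are the increments, and the hypotheses are the monotonicity of
    [T] and of [B]. *)
Lemma pd_form_step (X dx q delta : H) (U du : G) :
  0 <= '[X + q, - (t *: dx) - delta] - '[L (X + q), U - du] ->
  0 <= '[L (X + q + dx) - s *: du, U] ->
  pd_form X U <= pd_form (X - dx) (U - du) -
    (t * `|dx + q| ^+ 2 - t * `|q| ^+ 2 - 2 * '[L (dx + q), du]
     + s * `|du| ^+ 2) - 2 * '[X + q, delta].
Proof.
rewrite /pd_form !normB_sq !normD_sq !linearD !linearN /= !innerE.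
by rewrite (innerC q dx) (innerC du U); lra.
Qed.

Lemma pd_form_coercive (N : R) : (forall x, `|L x| <= N * `|x|) ->
  0 < t -> 0 < s -> N ^+ 2 < t * s ->
  exists2 c, 0 < c & forall x u, c * (`|x| ^+ 2 + `|u| ^+ 2) <= pd_form x u.
Proof.
move=> LN t0 s0 Nts; have [c c0 hc] := binary_form_coercive t0 s0 Nts.
exists c => // x u; rewrite (le_trans (hc _ _))// /pd_form.
have : '[L x, u] <= N * `|x| * `|u|.
  by rewrite (le_trans (inner_le_norm _ _))// ler_wpM2r.
by lra.
Qed.

End PrimalDualForm.

(** * Weak convergence *)

Section WeakConvergence.
Context {R : realType} {H G : hilbertType R} (L : {linear H -> G})
  (Ls : G -> H) (hLs : is_adjoint L Ls).

Lemma weak_cvg_linear (T : Type) (F : set_system T) (x : T -> H) (a : H) :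
  weak_cvg_to F x a -> weak_cvg_to F (fun n => L (x n)) (L a).
Proof.
move=> xa y; rewrite hLs; under eq_fun do rewrite hLs.
exact: xa.
Qed.

(** The terms quadratic in [(x, u)] cancel; what remains is affine and therefore passes to weak
    limits. *)
Lemma pd_form_sub (t s : R) (x a1 a2 : H) (u b1 b2 : G) :
  pd_form L t s (x - a1) (u - b1) - pd_form L t s (x - a2) (u - b2) =
  2 * (t * '[x, a2 - a1] - '[L x, b2 - b1] - '[u, L (a2 - a1)]
       + s * '[u, b2 - b1])
  + (pd_form L t s a1 b1 - pd_form L t s a2 b2).
Proof.
rewrite /pd_form !normB_sq !linearB /= !innerE.
by rewrite !(innerC u) !(innerC b1) !(innerC b2); ring.
Qed.

(* Opial's argument, with ultrafilters in place of subsequences: for two weak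
   limits [w1], [w2] the difference of the two convergent quantities is affine
   in the sequence, and comparing its limits along the two ultrafilters shows
   that the form vanishes at [w1 - w2]. *)
Lemma pd_opial (t s c : R) (x : nat -> H) (u : nat -> G) (M : R)
    (Z : set (H * G)) :
  0 < c -> (forall y v, c * (`|y| ^+ 2 + `|v| ^+ 2) <= pd_form L t s y v) ->
  (forall n, `|x n| <= M) -> (forall n, `|u n| <= M) ->
  (forall w, Z w -> cvgn (fun n => pd_form L t s (x n - w.1) (u n - w.2))) ->
  (forall U, UltraFilter U -> \oo `<=` U -> forall a b,
     weak_cvg_to U x a -> weak_cvg_to U u b -> Z (a, b)) ->
  exists2 w, Z w & weak_cvg_to \oo x w.1 /\ weak_cvg_to \oo u w.2.
Proof.
move=> c0 hc xM uM Zcvg Zlim.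
have lim_ex U : UltraFilter U -> \oo `<=` U ->
    exists2 w, Z w & weak_cvg_to U x w.1 /\ weak_cvg_to U u w.2.
  move=> UU ooU; have [a xa] := ultra_weak_compact xM.
  have [b ub] := ultra_weak_compact uM.
  by exists (a, b) => //; exact: Zlim UU ooU _ _ xa ub.
(* The limit [w0] along one fixed ultrafilter is the candidate; it remains to see that every other
   ultrafilter finer than [\oo] gives the same limit. *)
have [U0 [UU0 ooU0]] := ultraFilterLemma (_ : ProperFilter \oo).
have [w0 Zw0 [xw0 uw0]] := lim_ex _ UU0 ooU0.
exists w0 => //.
suff uniq U : UltraFilter U -> \oo `<=` U ->
    weak_cvg_to U x w0.1 /\ weak_cvg_to U u w0.2.
  by split=> y; apply: cvg_ultra => U UU ooU; [exact: (uniq U UU ooU).1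
    | exact: (uniq U UU ooU).2].
move=> UU ooU; have [w Zw [xw uw]] := lim_ex _ UU ooU.
suff -> : w0 = w by [].
have [d1 d2] : w.1 - w0.1 = 0 /\ w.2 - w0.2 = 0.
  pose m n := pd_form L t s (x n - w0.1) (u n - w0.2)
            - pd_form L t s (x n - w.1) (u n - w.2).
  have mcvg : cvgn m by apply: is_cvgB; exact: Zcvg.
  have mlim F (w' : H * G) : UltraFilter F -> \oo `<=` F ->
      weak_cvg_to F x w'.1 -> weak_cvg_to F u w'.2 ->
      limn m = pd_form L t s (w'.1 - w0.1) (w'.2 - w0.2)
             - pd_form L t s (w'.1 - w.1) (w'.2 - w.2).
    move=> UF ooF xw' uw'.
    have mF : m n @[n --> F] --> limn m by move=> A /mcvg; exact: ooF.
    apply: (cvg_unique _ mF) => //=.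
    rewrite pd_form_sub /m.
    rewrite (funext (fun n => pd_form_sub t s (x n) w0.1 w.1 (u n) w0.2 w.2)).
    apply: cvgD; last exact: cvg_cst.
    apply: cvgM; first exact: cvg_cst.
    apply: cvgD; [apply: cvgB; [apply: cvgB|]|].
    - by apply: cvgM; [exact: cvg_cst | exact: xw'].
    - exact: weak_cvg_linear.
    - exact: uw'.
    - by apply: cvgM; [exact: cvg_cst | exact: uw'].
  have := mlim U w UU ooU xw uw.
  rewrite (mlim U0 w0 UU0 ooU0 xw0 uw0).
  have -> : pd_form L t s (w0.1 - w.1) (w0.2 - w.2) =
      pd_form L t s (w.1 - w0.1) (w.2 - w0.2).
    rewrite /pd_form -[w0.1 - _]opprB -[w0.2 - _]opprB.
    by rewrite (linearN L) innerNl innerNr opprK !normrN.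
  have form0 : pd_form L t s 0 0 = 0.
    by rewrite /pd_form !normr0 (linear0 L) inner0l; ring.
  (* The limit of [m] is minus the form at [w - w0] along [U0] and plus the same value along [U], so
     this value is 0 and coercivity applies. *)
  rewrite !subrr form0 => eq0.
  have := hc (w.1 - w0.1) (w.2 - w0.2).
  have := sqr_ge0 `|w.1 - w0.1|; have := sqr_ge0 `|w.2 - w0.2| => h2 h1 h.
  by split; apply/eqP; rewrite -normr_eq0 -sqrf_eq0 eq_le ?h1 ?h2 andbT; nra.
rewrite [w0]surjective_pairing [w in RHS]surjective_pairing.
by congr (_, _); apply/eqP; rewrite eq_sym -subr_eq0 ?d1 ?d2.
Qed.

(** A continuous functional on the product is the sum of its restrictions to the two factors, and
    Riesz represents each of them by a vector. *)
Lemma weakly_cvg_pair (x : nat -> H) (u : nat -> G) (w : H * G) :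
  weak_cvg_to \oo x w.1 -> weak_cvg_to \oo u w.2 ->
  weakly_cvg (fun n => (x n, u n)) w.
Proof.
move=> xw uw f cf.
have /linear_boundedP/pinfty_ex_gt0[M M0 fM] :=
  continuous_linear_bounded 0 (cf 0).
have fE y v : f (y, v) = f (y, 0) + f (0, v).
  by rewrite -linearD; congr (f (_, _)) => /=; rewrite ?addr0 ?add0r.
have [a fa] : exists a, forall y, f (y, 0) = '[a, y].
  apply: (@riesz_representation _ _ _ M) => [k y v|y].
    have -> : (k *: y + v, 0) = k *: (y, 0) + (v, 0) :> H * G.
      by congr (_, _); rewrite /= scaler0 addr0.
    exact: linearP.
  by rewrite (le_trans (fM _))// prod_normE /= normr0 max_l.
have [b fb] : exists b, forall y, f (0, y) = '[b, y].
  apply: (@riesz_representation _ _ _ M) => [k y v|y].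
    have -> : (0, k *: y + v) = k *: (0, y) + (0, v) :> H * G.
      by congr (_, _); rewrite /= scaler0 addr0.
    exact: linearP.
  by rewrite (le_trans (fM _))// prod_normE /= normr0 max_r.
rewrite [w]surjective_pairing fE fa fb !(innerC _ w.1, innerC _ w.2).
under eq_fun do rewrite fE fa fb (innerC a) (innerC b).
by apply: cvgD; [exact: xw | exact: uw].
Qed.

End WeakConvergence.

(** * The primal-dual iteration *)

(** Split [w - y] as [(w - x) + (x - y)]: cocoercivity bounds the second part, Cauchy-Schwarz the
    first. The slack [c] makes the binary form with coefficients [(2 beta)^-1 + c], [2 beta] and
    [N = 1] positive definite, which yields [k]. *)
Lemma cocoercive_step (R : realType) (V : hilbertType R) (D : V -> V)
    (beta c : R) : 0 < beta -> 0 < c -> cocoercive beta D ->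
  exists2 k, 0 < k & forall x y w,
    - (2 * '[w - y, D x - D y]) <= ((2 * beta)^-1 + c) * `|w - x| ^+ 2
      - k * (`|w - x| ^+ 2 + `|D x - D y| ^+ 2).
Proof.
move=> beta0 c0 hD.
have [||| k k0 hk] := @binary_form_coercive _ ((2 * beta)^-1 + c) (2 * beta) 1.
- by rewrite addr_gt0 ?invr_gt0 ?mulr_gt0.
- by rewrite mulr_gt0.
- rewrite mulrDl mulVf ?gt_eqF ?mulr_gt0// expr1n ltrDl.
  by rewrite !mulr_gt0.
exists k => // x y w.
have := hk `|w - x| `|D x - D y|.
have := inner_le_norm (- (w - x)) (D x - D y); rewrite normrN innerNl.
have := hD x y.
have -> : w - y = (w - x) + (x - y) by rewrite subrKA.
by rewrite [in X in _ -> _ -> _ -> X]innerDl; lra.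
Qed.

Section Iteration.
Context {R : realType} {H G : hilbertType R} (T : H -> set H) (B : G -> set G)
  (L : {linear H -> G}) (Ls : G -> H) (D : H -> H)
  (tau sigma zeta beta eps N : R) (z x : nat -> H) (u : nat -> G)
  (mT : maximally_monotone T)
  (mB : maximally_monotone B)
  (hLs : is_adjoint L Ls)
  (LN : forall y, `|L y| <= N * `|y|)
  (hD : cocoercive beta D)
  (beta0 : 0 < beta)
  (tau0 : 0 < tau)
  (sigma0 : 0 < sigma)
  (eps0 : 0 < eps)
  (zeta0 : 0 < zeta)
  (step1 : tau <= 2 * beta * eps)
  (step2 : tau * sigma * N ^+ 2 + tau ^+ 2 * zeta ^+ 2 < 1 - eps)
  (stepT : forall n,
  T (z n.+1) (tau^-1 *: (x n - x n.+1) - Ls (u n) - D (x n)))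
  (stepB : forall n,
  B (L (z n.+1 + (x n.+1 - x n)) - sigma^-1 *: (u n.+1 - u n)) (u n.+1))
  (stepC : forall n,
  `|z n.+1 - x n.+1| <= tau * zeta * `|z n.+1 - x n|).

Let form := pd_form L tau^-1 sigma^-1.

(** For [T] the sum of [A] and [C] this is the solution set, written as membership in the graphs of
    [T] and [B], to which maximality applies. *)
Definition kkt (w : H * G) :=
  T w.1 (- D w.1 - Ls w.2) /\ B (L w.1) w.2.

Let tauV0 : 0 < tau^-1. Proof. by rewrite invr_gt0. Qed.
Let sigmaV0 : 0 < sigma^-1. Proof. by rewrite invr_gt0. Qed.

Lemma form_coercive :
  exists2 c, 0 < c & forall y v, c * (`|y| ^+ 2 + `|v| ^+ 2) <= form y v.
Proof.
apply: (pd_form_coercive LN tauV0 sigmaV0).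
rewrite -invfM -[ltRHS]mul1r ltr_pdivlMr ?mulr_gt0// mulrC.
have st2 := step2; have e0 := eps0.
by have := sqr_ge0 (tau * zeta); rewrite exprMn; lra.
Qed.

Lemma form_descent : exists2 k, 0 < k & forall w, kkt w -> forall n,
  form (x n.+1 - w.1) (u n.+1 - w.2) +
    k * (`|z n.+1 - x n| ^+ 2 + `|u n.+1 - u n| ^+ 2
         + `|D (x n) - D w.1| ^+ 2)
  <= form (x n - w.1) (u n - w.2).
Proof.
have st1 := step1; have st2 := step2; have e0 := eps0.
(* What remains of the coefficient [tau^-1] of [|z_{n+1} - x_n|^2] after paying [tau zeta^2] for the
   correction [z_{n+1} - x_{n+1}] and [eps / tau], which is at least [(2 beta)^-1], for [D]. *)
pose a := tau^-1 * (1 - eps - tau ^+ 2 * zeta ^+ 2).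
have Na : N ^+ 2 < a * sigma^-1.
  rewrite ltr_pdivlMr// /a ltr_pdivlMl//; lra.
have a0 : 0 < a.
  by rewrite -(pmulr_lgt0 _ sigmaV0) (le_lt_trans _ Na)// sqr_ge0.
have [c c0 hc] := binary_form_coercive a0 sigmaV0 Na.
(* Half of the coercivity constant serves as the slack in [cocoercive_step]; the other half stays in
   the decrease. *)
have c20 : 0 < c / 2 by rewrite divr_gt0.
have [k k0 hk] := cocoercive_step beta0 c20 hD.
exists (Num.min (c / 2) k) => [|w [Tw Bw] n]; first by rewrite lt_min c20.
have T_ge0 : 0 <=
    '[z n.+1 - w.1, - (tau^-1 *: (x n.+1 - x n)) - (D (x n) - D w.1)]
    - '[L (z n.+1 - w.1), u n - w.2].
  have := mT.1 _ _ _ _ (stepT n) Tw; rewrite mul0r.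
  rewrite -(opprB (x n.+1)) !innerE !(linearB L) /= !innerE -!hLs; lra.
have B_ge0 : 0 <= '[L (z n.+1 - w.1 + (x n.+1 - x n))
    - sigma^-1 *: (u n.+1 - u n), u n.+1 - w.2].
  have := mB.1 _ _ _ _ (stepB n) Bw; rewrite mul0r.
  by rewrite !(linearD L, linearN L) /= !innerE; lra.
have e1 : x n.+1 - w.1 + (z n.+1 - x n.+1) = z n.+1 - w.1
  by rewrite addrC subrKA.
have e2 : x n.+1 - w.1 - (x n.+1 - x n) = x n - w.1
  by rewrite opprB addrC subrKA.
have e3 : x n.+1 - x n + (z n.+1 - x n.+1) = z n.+1 - x n
  by rewrite addrC subrKA.
have e4 : u n.+1 - w.2 - (u n.+1 - u n) = u n - w.2
  by rewrite opprB addrC subrKA.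
have := @pd_form_step _ _ _ L tau^-1 sigma^-1 (x n.+1 - w.1) (x n.+1 - x n)
  (z n.+1 - x n.+1) (D (x n) - D w.1) (u n.+1 - w.2) (u n.+1 - u n).
rewrite e1 e2 e3 e4 => /(_ T_ge0 B_ge0); rewrite -/form.
have q2 : tau^-1 * `|z n.+1 - x n.+1| ^+ 2 <=
    tau^-1 * (tau ^+ 2 * zeta ^+ 2) * `|z n.+1 - x n| ^+ 2.
  rewrite -mulrA ler_pM2l// -!exprMn ler_pXn2r ?nnegrE//.
    by rewrite !mulr_ge0// ltW.
have := hk (x n) w.1 (z n.+1).
have := hc `|z n.+1 - x n| `|u n.+1 - u n|.
have Ld : '[L (z n.+1 - x n), u n.+1 - u n] <=
    N * `|z n.+1 - x n| * `|u n.+1 - u n|.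
  by rewrite (le_trans (inner_le_norm _ _))// ler_wpM2r.
have epsbeta : (2 * beta)^-1 <= tau^-1 * eps.
  by rewrite ler_pdivlMl// ler_pdivrMr ?mulr_gt0//; lra.
have := ler_wpM2r (sqr_ge0 `|z n.+1 - x n|) epsbeta.
have min1 : Num.min (c / 2) k <= c / 2 by rewrite ge_min lexx.
have min2 : Num.min (c / 2) k <= k by rewrite ge_min lexx orbT.
have := ler_wpM2r (sqr_ge0 `|z n.+1 - x n|) min1.
have := ler_wpM2r (sqr_ge0 `|u n.+1 - u n|) min1.
have := ler_wpM2r (sqr_ge0 `|D (x n) - D w.1|) min2.
have := mulr_ge0 (ltW k0) (sqr_ge0 `|z n.+1 - x n|).
have := mulr_ge0 (ltW c20) (sqr_ge0 `|u n.+1 - u n|).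
rewrite /a; lra.
Qed.


Lemma kkt_weak_limit (U : set_system nat) {UU : ProperFilter U} (M : R)
    (a : H) (b : G) (c : H) :
  (forall n, `|x n| <= M) -> (forall n, `|u n| <= M) ->
  (forall n, `|z n.+1 - x n| <= M) ->
  z n.+1 - x n @[n --> U] --> 0 -> x n.+1 - x n @[n --> U] --> 0 ->
  u n.+1 - u n @[n --> U] --> 0 -> D (x n) @[n --> U] --> c ->
  weak_cvg_to U x a -> weak_cvg_to U u b -> kkt (a, b).
Proof.
move=> xM uM dM d0 dx0 du0 Dc xa ub.
(* Cocoercivity bounds [beta |D x_n - D a|^2] by ['[x_n - a, D x_n - D a]], which tends to 0 as a
   weak-strong product. *)
have Da : D a = c.
  have xxa0 : '[x n - a, D (x n) - D a] @[n --> U] --> '[a - a, c - D a].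
    apply: (@cvg_inner_weak _ _ _ _ _ _ _ _ _ (M + `|a|)).
    - by move=> n; rewrite (le_trans (ler_normB _ _))// lerD2r.
    - by apply: weak_cvgD => //; exact: cvg_cst.
    - by apply: cvgB => //; exact: cvg_cst.
  rewrite subrr inner0l in xxa0.
  have Dca : beta * `|D (x n) - D a| ^+ 2 @[n --> U] --> beta * `|c - D a| ^+ 2.
    apply: cvgM; first exact: cvg_cst.
    rewrite expr2; apply: cvgM; apply: cvg_norm; apply: cvgB => //;
      exact: cvg_cst.
  have : beta * `|c - D a| ^+ 2 <= 0.
    by apply: ler_cvg_to Dca xxa0 _; apply: nearW => n; exact: hD.
  rewrite pmulr_rle0// => h; apply/eqP; rewrite eq_sym -subr_eq0 -normr_eq0.
  by rewrite -sqrf_eq0 eq_le h sqr_ge0.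
rewrite /kkt /= Da; apply: (maximally_monotone_mem_pair mT mB).
move=> y v w b' Tyv Bwb'.
pose e n := - (tau^-1 *: (x n.+1 - x n)) - D (x n) - v.
pose e' n := L (x n.+1 - x n) - sigma^-1 *: (u n.+1 - u n) - w.
have ec : e n @[n --> U] --> - c - v.
  rewrite -[- c]add0r -oppr0 -[X in - X - _ - _](scaler0 _ tau^-1).
  apply: cvgB; last exact: cvg_cst.
  by apply: cvgB => //; apply: cvgN; apply: cvgZ => //; exact: cvg_cst.
have e'w : e' n @[n --> U] --> - w.
  rewrite -[- w]add0r -[X in X + _](subrr 0).
  rewrite -[X in _ - X + _](scaler0 _ sigma^-1).
  apply: cvgB; last exact: cvg_cst.
  apply: cvgB; last by apply: cvgZ => //; exact: cvg_cst.
  apply: (@cvg_dist_le _ _ _ _ _ _ _ (fun n => N * `|x n.+1 - x n|)).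
    by move=> n; rewrite subr0.
  rewrite -(mulr0 N); apply: cvgM; first exact: cvg_cst.
  by apply/norm_cvg0P.
have za : weak_cvg_to U (fun n => z n.+1) a.
  rewrite -[a]addr0 (_ : (fun n => _) = (fun n => x n + (z n.+1 - x n))).
    exact: weak_cvgD.
  by apply/funext => n; rewrite subrKC.
have u'b : weak_cvg_to U (fun n => u n.+1) b.
  rewrite -[b]addr0 (_ : (fun n => _) = (fun n => u n + (u n.+1 - u n))).
    exact: weak_cvgD.
  by apply/funext => n; rewrite subrKC.
have Lza := weak_cvg_linear hLs za.
have zM n : `|z n.+1| <= M + M.
  by rewrite -(subrKC (x n) (z n.+1)) (le_trans (ler_normD _ _))// lerD.
have N0 : 0 <= `|N| by [].
have LzM n : `|L (z n.+1)| <= `|N| * (M + M).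
  rewrite (le_trans (LN _))// (le_trans (ler_wpM2r _ (ler_norm N)))//.
  by rewrite ler_wpM2l.
(* The sum of the two monotonicity products, regrouped so that each term has a strongly convergent
   or fixed factor: the two weak-weak products merge into ['[L z_{n+1}, u_{n+1} - u_n]]. *)
pose g n := '[z n.+1, e n] - '[y, e n] + '[L (z n.+1), u n.+1 - u n]
  + '[u n, L y] + '[u n.+1, e' n] - '[b', e' n] - '[L (z n.+1), b'].
have gl : g n @[n --> U] --> '[a, - c - v] - '[y, - c - v] + '[L a, 0]
    + '[b, L y] + '[b, - w] - '[b', - w] - '[L a, b'].
  apply: cvgB; last exact: Lza.
  apply: cvgB; last exact: cvg_inner.
  apply: cvgD; last first.
    apply: (@cvg_inner_weak _ _ _ _ _ _ _ _ _ M) => // n; exact: uM.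
  apply: cvgD; last exact: ub.
  apply: cvgD; last exact: (@cvg_inner_weak _ _ _ _ _ _ _ _ _ _ LzM).
  apply: cvgB; last exact: cvg_inner.
  exact: (@cvg_inner_weak _ _ _ _ _ _ _ _ _ _ zM).
have : 0 <= '[a, - c - v] - '[y, - c - v] + '[L a, 0]
    + '[b, L y] + '[b, - w] - '[b', - w] - '[L a, b'].
  apply: (cvgr_to_ge gl); apply: nearW => n.
  have h1 := mT.1 _ _ _ _ (stepT n) Tyv.
  have h2 := mB.1 _ _ _ _ (stepB n) Bwb'.
  rewrite mul0r in h1; rewrite mul0r in h2.
  move: (addr_ge0 h1 h2); congr (_ <= _).
  rewrite /g /e /e' -(opprB (x n.+1)) !(linearD L, linearN L) /= !innerE.
  rewrite -!hLs !(innerC (u n.+1)) !(innerC (u n)) !(innerC b').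
  ring.
congr (_ <= _).
rewrite !innerE -!hLs.
rewrite !(innerC b) !(innerC b'); ring.
Qed.

Lemma iteration_cvg (w0 : H * G) : kkt w0 ->
  [/\ (\sum_(0 <= k <oo) (`|z k.+1 - x k| ^+ 2)%:E < +oo)%E,
      (\sum_(0 <= k <oo) (`|x k.+1 - x k| ^+ 2)%:E < +oo)%E
    & (\sum_(0 <= k <oo) (`|u k.+1 - u k| ^+ 2)%:E < +oo)%E] /\
  exists2 w : H * G, kkt w & weakly_cvg (fun n => (x n, u n)) w.
Proof.
move=> kkt0.
have [c c0 hc] := form_coercive; have [k k0 hk] := form_descent.
pose V (w : H * G) n := form (x n - w.1) (u n - w.2).
have V0 w n : 0 <= V w n.
  by rewrite (le_trans _ (hc _ _))// mulr_ge0 ?(ltW c0)// addr_ge0 ?sqr_ge0.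
(* One telescoping argument serves all four sequences, each being dominated by a multiple of the
   decrease in [form_descent]. *)
have Vf (f : nat -> R) (C : R) w : kkt w -> 0 < C -> (forall n, 0 <= f n) ->
    (forall n, f n <= C * (`|z n.+1 - x n| ^+ 2 + `|u n.+1 - u n| ^+ 2
       + `|D (x n) - D w.1| ^+ 2)) ->
    (\sum_(0 <= k <oo) (f k)%:E < +oo)%E /\ f n @[n --> \oo] --> 0.
  move=> kw C0 f0 fC.
  apply: (@telescoping_summable _ (k / C) (V w) f) => //.
    by rewrite divr_gt0.
  move=> n; apply: le_trans (hk _ kw n); rewrite lerD2l.
  by rewrite -mulrA ler_pM2l// ler_pdivrMl.
have [sd d0] : (\sum_(0 <= k <oo) (`|z k.+1 - x k| ^+ 2)%:E < +oo)%E /\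
    `|z n.+1 - x n| ^+ 2 @[n --> \oo] --> (0 : R).
  apply: (Vf _ 1 w0) => // n; rewrite mul1r -addrA lerDl addr_ge0 ?sqr_ge0//.
have [su du0] : (\sum_(0 <= k <oo) (`|u k.+1 - u k| ^+ 2)%:E < +oo)%E /\
    `|u n.+1 - u n| ^+ 2 @[n --> \oo] --> (0 : R).
  apply: (Vf _ 1 w0) => // n; rewrite mul1r addrAC lerDr addr_ge0 ?sqr_ge0//.
have [_ D0] : (\sum_(0 <= k <oo) (`|D (x k) - D w0.1| ^+ 2)%:E < +oo)%E /\
    `|D (x n) - D w0.1| ^+ 2 @[n --> \oo] --> (0 : R).
  apply: (Vf _ 1 w0) => // n; rewrite mul1r lerDr addr_ge0 ?sqr_ge0//.
have [sx dx0] : (\sum_(0 <= k <oo) (`|x k.+1 - x k| ^+ 2)%:E < +oo)%E /\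
    `|x n.+1 - x n| ^+ 2 @[n --> \oo] --> (0 : R).
  (* By [stepC] and the triangle inequality through [z n.+1], [|x_{n+1} - x_n|] is at most
     [(1 + tau zeta) |z_{n+1} - x_n|]. *)
  have C0 : 0 < 1 + tau * zeta by rewrite addr_gt0 ?mulr_gt0.
  apply: (Vf _ ((1 + tau * zeta) ^+ 2) w0) => // [|n].
    by rewrite exprn_gt0.
  apply: (@le_trans _ _ ((1 + tau * zeta) ^+ 2 * `|z n.+1 - x n| ^+ 2)).
    rewrite -exprMn ler_pXn2r ?nnegrE// ?mulr_ge0 ?(ltW C0)//.
    rewrite -(subrKA (z n.+1)) (le_trans (ler_normD _ _))// distrC.
    by rewrite addrC mulrDl mul1r lerD2l; exact: stepC.
  by rewrite ler_pM2l ?exprn_gt0// -addrA lerDl addr_ge0 ?sqr_ge0.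
split=> //.
have Vn w n : kkt w -> V w n.+1 <= V w n.
  move=> kw; apply: le_trans (hk _ kw n); by rewrite lerDl mulr_ge0 ?(ltW k0)//.
have VV0 n : V w0 n <= V w0 0.
  by elim: n => // n; exact: le_trans (Vn _ _ kkt0).
(* The inequality [r <= 1 + r^2] gives a bound without square roots. *)
have bounded (r K C : R) : 0 < C -> 0 <= K -> C * r ^+ 2 <= K -> r <= 1 + K / C.
  move=> C0 K0; rewrite -ler_pdivlMl// mulrC => h.
  by rewrite (le_trans _ (lerD (lexx 1) h))//; have := sqr_ge0 (r - 1); nra.
pose M := 1 + V w0 0 / c + `|w0.1| + `|w0.2| + (1 + V w0 0 / k).
have Vc0 : 0 <= V w0 0 / c by rewrite divr_ge0// ltW.
have Vk0 : 0 <= V w0 0 / k by rewrite divr_ge0// ltW.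
have cxM n : c * (`|x n - w0.1| ^+ 2 + `|u n - w0.2| ^+ 2) <= V w0 0.
  exact: le_trans (hc _ _) (VV0 n).
have w1_ge0 : 0 <= `|w0.1| by [].
have w2_ge0 : 0 <= `|w0.2| by [].
have xM n : `|x n| <= M.
  rewrite -(subrK w0.1 (x n)) (le_trans (ler_normD _ _))//.
  have := bounded `|x n - w0.1| _ _ c0 (V0 w0 0) _.
  rewrite /M => h; have := h (le_trans _ (cxM n)).
  by rewrite ler_pM2l// lerDl sqr_ge0 => /(_ isT); lra.
have uM n : `|u n| <= M.
  rewrite -(subrK w0.2 (u n)) (le_trans (ler_normD _ _))//.
  have := bounded `|u n - w0.2| _ _ c0 (V0 w0 0) _.
  rewrite /M => h; have := h (le_trans _ (cxM n)).
  by rewrite ler_pM2l// lerDr sqr_ge0 => /(_ isT); lra.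
have dM n : `|z n.+1 - x n| <= M.
  have : k * `|z n.+1 - x n| ^+ 2 <= V w0 0.
    apply: le_trans (VV0 n); apply: le_trans (hk _ kkt0 n).
    rewrite ler_wpDl//; first exact: V0.
    by rewrite ler_pM2l// -addrA lerDl addr_ge0 ?sqr_ge0.
  by move=> /(bounded _ _ _ k0 (V0 w0 0)); rewrite /M; lra.
have Vcvg w : kkt w -> cvgn (V w).
  move=> kw; apply: nonincreasing_is_cvgn.
    by apply/nonincreasing_seqP => n; exact: Vn.
  by exists 0 => _ [n _ <-]; exact: V0.
have Vlim U : UltraFilter U -> \oo `<=` U -> forall a b,
    weak_cvg_to U x a -> weak_cvg_to U u b -> kkt (a, b).
  move=> UU ooU a b; apply: (kkt_weak_limit xM uM dM).
  - by move=> S0 /(norm_sq_cvg0 d0)/ooU.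
  - by move=> S0 /(norm_sq_cvg0 dx0)/ooU.
  - by move=> S0 /(norm_sq_cvg0 du0)/ooU.
  - by move=> S0 /((subr_cvg0 _ _).1 (norm_sq_cvg0 D0))/ooU.
have [w kw [xw uw]] := @pd_opial _ _ _ L Ls hLs _ _ _ x u M kkt c0 hc xM uM
  Vcvg Vlim.
by exists w => //; exact: weakly_cvg_pair.
Qed.

End Iteration.

(** * From the algorithm to the abstract iteration *)

Lemma kktE (R : realType) (H G : hilbertType R) (A : H -> set H)
    (B : G -> set G) (C D : H -> H) (L : {linear H -> G}) (Ls : G -> H) :
  kkt (op_add A (op_of_fun C)) B L Ls D = pd_solutions A B C D L Ls.
Proof.
apply/seteqP; split=> -[x u]; rewrite /kkt /pd_solutions /=.
  move=> [[v [_ [Av -> e]]] BLx]; split; last first.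
    by exists (L x) => //; rewrite subrr.
  by exists v => //; rewrite -e addrAC subrK addNr.
move=> [[v Av e] [y By /subr0_eq yL]]; rewrite -yL; split=> //.
exists v, (C x); split=> //; rewrite -opprD.
by apply/esym/eqP; rewrite -subr_eq0 opprK addrA e.
Qed.

Lemma resolvent_scale (R : realType) (V : hilbertType R) (A : V -> set V)
    (a : R) (y z : V) :
  resolvent (op_scale a A) y z -> exists2 v, A z v & y = z + a *: v.
Proof. by move=> [_ [_ [-> [v Av <-] ->]]]; exists v. Qed.

(** Here [p] is [C x_n] and [c] is [C z_{n+1}]: the correction trades the first for the second, so
    that [C] is evaluated at the same point as [A]. *)
Lemma primal_step (R : realType) (V : lmodType R) (tau : R)
    (x x' z v l p d c : V) : tau != 0 ->
  x - tau *: (l + p + d) = z + tau *: v -> x' = z - tau *: (c - p) ->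
  tau^-1 *: (x - x') - l - d = v + c.
Proof.
move=> tau0 /eqP; rewrite subr_eq => /eqP -> ->.
have -> (S Q : V) :
    z + tau *: v + tau *: S - (z - tau *: Q) = tau *: (v + S + Q).
  by rewrite opprB addrC -!addrA addKr [RHS]scalerDr scalerDr addrC addrA.
rewrite scalerA mulVf// scale1r (addrAC l) (addrA v) addrACA subrr addr0.
by rewrite (addrAC v) -[LHS]addrA -opprD addrK.
Qed.

(** The extrapolated point [2 z - x - q] equals [z + (x' - x)], which removes [q] from the dual
    inclusion. *)
Lemma dual_step (R : realType) (H G : hilbertType R) (L : {linear H -> G})
    (sigma : R) (x x' z q : H) (u u' w : G) : sigma != 0 ->
  u + sigma *: L (2%:R *: z - x - q) = u' + sigma *: w -> x' = z - q ->
  w = L (z + (x' - x)) - sigma^-1 *: (u' - u).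
Proof.
move=> sigma0 e ->; apply: (scalerI sigma0).
rewrite scalerBr scalerA divff// scale1r opprB.
have <- : 2%:R *: z - x - q = z + (z - q - x).
  by rewrite scaler_nat mulr2n -!addrA (addrC (- q)).
by rewrite addrA [_ + u]addrC e addrAC subrr add0r.
Qed.

Theorem theorem4p2 (R : realType) (H G : hilbertType R)
  (rho : R) (A : H -> set H) (hA : maximally_rho_monotone rho A)
  (B : G -> set G) (hB : maximally_monotone B)
  (L : {linear H -> G}) (hL : bounded_operator L)
  (Ls : G -> H) (hLs : is_adjoint L Ls)
  (zeta : R) (hzeta : 0 < zeta) (C : H -> H) (hC : zeta.-lipschitz C)
  (beta : R) (hbeta : 0 < beta) (D : H -> H) (hD : cocoercive beta D)
  (hAC : maximally_monotone (op_add A (op_of_fun C)))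
  (hZ : pd_solutions A B C D L Ls !=set0)
  (sigma tau : R) (hsigma : 0 < sigma) (htau : 0 < tau)
  (htaurho : -1 < tau * rho)
  (eps : R) (heps0 : 0 < eps) (heps1 : eps < 1)
  (p z q x : nat -> H) (u : nat -> G)
  (halg : forall n : nat,
    [/\ p n.+1 = C (x n),
        resolvent (op_scale tau A)
          (x n - tau *: (Ls (u n) + p n.+1 + D (x n))) (z n.+1),
        q n.+1 = tau *: (C (z n.+1) - p n.+1),
        resolvent (op_scale sigma (op_inv B))
          (u n + sigma *: L (2%:R *: z n.+1 - x n - q n.+1)) (u n.+1)
      & x n.+1 = z n.+1 - q n.+1])
  (hstep1 : tau <= 2%:R * beta * eps)
  (hstep2 : tau * sigma * op_norm L ^+ 2 + tau ^+ 2 * zeta ^+ 2 < 1 - eps) :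
  [/\ (\sum_(0 <= k <oo) (`|z k.+1 - x k| ^+ 2)%:E < +oo)%E,
      (\sum_(0 <= k <oo) (`|x k.+1 - x k| ^+ 2)%:E < +oo)%E
    & (\sum_(0 <= k <oo) (`|u k.+1 - u k| ^+ 2)%:E < +oo)%E] /\
  exists2 xu : H * G, pd_solutions A B C D L Ls xu
    & weakly_cvg (fun n => (x n, u n)) xu.
Proof.
have LN := op_norm_le hL.
have xE n : x n.+1 = z n.+1 - q n.+1 by have [] := halg n.
have qE n : q n.+1 = tau *: (C (z n.+1) - C (x n)).
  by have [-> _ -> _ _] := halg n.
have stepT n : op_add A (op_of_fun C) (z n.+1)
    (tau^-1 *: (x n - x n.+1) - Ls (u n) - D (x n)).
  have [pE /resolvent_scale[v Av e] _ _ _] := halg n.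
  exists v, (C (z n.+1)); split=> //.
  apply: (primal_step (lt0r_neq0 htau) e); by rewrite pE -qE.
have stepB n :
    B (L (z n.+1 + (x n.+1 - x n)) - sigma^-1 *: (u n.+1 - u n)) (u n.+1).
  have [_ _ _ /resolvent_scale[w Bw e] xn] := halg n.
  by rewrite -(dual_step (lt0r_neq0 hsigma) e xn).
have stepC n : `|z n.+1 - x n.+1| <= tau * zeta * `|z n.+1 - x n|.
  rewrite xE qE opprB addrC subrK normrZ gtr0_norm// -mulrA ler_pM2l//.
  exact: (hC (z n.+1, x n)).
have [w0] := hZ; rewrite -kktE => kkt0.
have := iteration_cvg hAC hB hLs LN hD hbeta htau hsigma heps0 hzeta hstep1
  hstep2 stepT stepB stepC kkt0.
by rewrite kktE.
Qed.
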